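(* Let $G$ be a weighted simple graph on the nodes $1,\dots,n$ with symmetric weight matrix $W=(w_{ij})$, where $w_{ij}=0$ if the nodes $i$ and $j$ are not connected by an edge. Let $a_1,\dots,a_n$ be positive real numbers and let $r=(r_{ij})$ be a symmetric $n\times n$ matrix. Let $T_v^r$ be the operator defined by $$(T_v^r\mathbf{y})_i=\sum_j(a_iy_i-a_jy_j)\,w_{ij}\,\frac{2r_{ij}}{a_i+a_j}.$$ Then $T_v^r$ is non-negative in $\ell^2_X$, where $X=\mathrm{diag}(ca_i)$ for some positive $c$. More precisely, $$\langle\mathbf{y},T_v^r\mathbf{y}\rangle_X=\frac{c}{2}\sum_{i,j}(\tilde y_i-\tilde y_j)^2\,\tilde w_{ij}\ge 0,$$ with $\tilde w_{ij}:=w_{ij}\frac{2r_{ij}}{a_i+a_j}$ and $\tilde y_i:=a_iy_i$. In particular, $T_v^r\mathbf{y}=0$ if and only if the quantity $a_iy_i$ is constant on every connected component of the graph $G$.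
   Context: For a positive definite real $n\times n$ matrix $A$, $\langle \mathbf{y},\mathbf{z}\rangle_A:=\mathbf{y}^tA\mathbf{z}$ for $\mathbf{y},\mathbf{z}\in\mathbb{R}^n$; $\ell^2_X$ denotes $\mathbb{R}^n$ with the inner product $\langle\cdot,\cdot\rangle_X$. The operator above is the general transport operator $(T_v^r\mathbf{y})_i=\sum_j[r_{ij}(y_i-y_j)-\bar v_{ij}(y_i+y_j)]w_{ij}$ in the case $\bar v_{ij}=\frac{a_j-a_i}{a_j+a_i}\,r_{ij}$.
   Formalization: The claim fails without sign conditions, so non-negativity is stated assuming w_ij r_ij ≥ 0 on every edge, and the characterization of T_v^r y = 0 assuming w_ij r_ij > 0 on every edge; the identity needs no sign condition. *)

(* Defs.v *)
From HB Require Import structures.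
From mathcomp Require Import all_boot all_order all_algebra.
From mathcomp Require Import reals.
From mathcomp Require Import ring lra.

Set Implicit Arguments.
Unset Strict Implicit.
Unset Printing Implicit Defensive.

Import Order.TTheory GRing.Theory Num.Theory.
Local Open Scope ring_scope.

Definition simple_graph (n : nat) (e : rel 'I_n) : Prop :=
  symmetric e /\ irreflexive e.

(* No sign is imposed on the weights here. *)
Definition weight_matrix (R : realType) (n : nat) (e : rel 'I_n)
    (W : 'M[R]_n) : Prop :=
  W^T = W /\ forall i j, ~~ e i j -> W i j = 0.

Definition inner (R : realType) (n : nat) (A : 'M[R]_n) (y z : 'cV[R]_n) : R :=
  (y^T *m A *m z) 0 0.

Definition posdef (R : realType) (n : nat) (A : 'M[R]_n) : Prop :=
  A^T = A /\ forall y : 'cV[R]_n, y != 0 -> 0 < inner A y y.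

(* On a real space this is a condition on the quadratic form only: it does not
   include self-adjointness. *)
Definition nonneg_in (R : realType) (n : nat) (A : 'M[R]_n)
    (T : 'cV[R]_n -> 'cV[R]_n) : Prop :=
  forall y, 0 <= inner A y (T y).

Definition Xmx (R : realType) (n : nat) (c : R) (a : 'I_n -> R) : 'M[R]_n :=
  diag_mx (\row_i (c * a i)).

Definition general_transport (R : realType) (n : nat) (W r vbar : 'M[R]_n)
    (y : 'cV[R]_n) : 'cV[R]_n :=
  \col_i \sum_j (r i j * (y i 0 - y j 0) - vbar i j * (y i 0 + y j 0)) * W i j.

Definition transport (R : realType) (n : nat) (W r : 'M[R]_n) (a : 'I_n -> R)
    (y : 'cV[R]_n) : 'cV[R]_n :=
  \col_i \sum_j (a i * y i 0 - a j * y j 0) * W i j * (2 * r i j / (a i + a j)).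

Lemma transportE (R : realType) (n : nat) (W r : 'M[R]_n) (a : 'I_n -> R)
    (y : 'cV[R]_n) :
  (forall i, 0 < a i) ->
  transport W r a y =
  general_transport W r (\matrix_(i, j) ((a j - a i) / (a j + a i) * r i j)) y.
Proof.
move=> a0; apply/colP => i; rewrite !mxE; apply: eq_bigr => j _; rewrite mxE.
have aij : a j + a i != 0 by rewrite gt_eqF // addr_gt0.
by rewrite (addrC (a i)); field.
Qed.

Definition tilde_w (R : realType) (n : nat) (W r : 'M[R]_n) (a : 'I_n -> R)
    (i j : 'I_n) : R :=
  W i j * (2 * r i j / (a i + a j)).

Definition tilde_y (R : realType) (n : nat) (a : 'I_n -> R) (y : 'cV[R]_n)
    (i : 'I_n) : R :=
  a i * y i 0.

Definition constant_on_components (R : realType) (n : nat) (e : rel 'I_n)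
    (f : 'I_n -> R) : Prop :=
  forall i j, connect e i j -> f i = f j.

(* Main.v *)
(* In the coordinates tilde_y the operator is the Laplacian of the symmetric
   weight tilde_w, and the factor a_i in X turns <y, T y>_X into the Dirichlet
   form of that Laplacian. When tilde_w is positive on edges the form vanishes
   only if tilde_y agrees along every edge. *)

Require Import Defs.
From HB Require Import structures.
From mathcomp Require Import all_boot all_order all_algebra.
From mathcomp Require Import reals.
From mathcomp Require Import ring.

Set Implicit Arguments.
Unset Strict Implicit.
Unset Printing Implicit Defensive.

Import Order.TTheory GRing.Theory Num.Theory.
Local Open Scope ring_scope.

Lemma inner_XmxE (R : realType) (n : nat) (c : R) (a : 'I_n -> R)
    (y z : 'cV[R]_n) :
  inner (Xmx c a) y z = c * \sum_i a i * y i 0 * z i 0.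
Proof.
rewrite /inner /Xmx mul_mx_diag mxE mulr_sumr.
by apply: eq_bigr => i _; rewrite !mxE; ring.
Qed.

Lemma posdef_Xmx (R : realType) (n : nat) (c : R) (a : 'I_n -> R) :
  (forall i, 0 < a i) -> 0 < c -> posdef (Xmx c a).
Proof.
move=> a0 c0; split; first exact: tr_diag_mx.
move=> y; rewrite inner_XmxE pmulr_rgt0 //; case/cV0Pn => i yi0.
have ge0 j : 0 <= a j * y j 0 * y j 0.
  by rewrite -mulrA -expr2 mulr_ge0 ?sqr_ge0 // ltW.
rewrite (bigD1 i) //= ltr_pwDl ?sumr_ge0 //.
by rewrite -mulrA -expr2 mulr_gt0 // exprn_even_gt0.
Qed.

(** Summation by parts: as [w] is symmetric, swapping the two indices preserves the left side, and
    [u i * (u i - u j) + u j * (u j - u i)] is the square. *)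
Lemma dirichlet_form (R : numFieldType) (I : finType) (w : I -> I -> R)
    (u : I -> R) :
  (forall i j, w i j = w j i) ->
  \sum_i u i * (\sum_j (u i - u j) * w i j) =
  2^-1 * \sum_i \sum_j (u i - u j) ^+ 2 * w i j.
Proof.
move=> wC; set S := LHS.
have SE : S = \sum_i \sum_j u i * (u i - u j) * w i j.
  by apply: eq_bigr => i _; rewrite mulr_sumr; apply: eq_bigr => j _; ring.
have SE' : S = \sum_i \sum_j u j * (u j - u i) * w i j.
  rewrite SE exchange_big; apply: eq_bigr => i _; apply: eq_bigr => j _.
  by rewrite wC.
have -> : \sum_i \sum_j (u i - u j) ^+ 2 * w i j = S + S.
  rewrite {1}SE SE' -big_split; apply: eq_bigr => i _.
  by rewrite -big_split; apply: eq_bigr => j _ /=; ring.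
by field.
Qed.

(** Equality propagates along a path one edge at a time; the edgewise form is what a vanishing
    Dirichlet form yields. *)
Lemma constant_on_componentsP (R : realType) (n : nat) (e : rel 'I_n)
    (f : 'I_n -> R) :
  constant_on_components e f <-> forall i j, e i j -> f i = f j.
Proof.
split=> [fC i j eij | fE i j]; first exact/fC/connect1.
case/connectP => p + ->; elim: p i => //= k p IHp i /andP[eik ekp].
by rewrite (fE _ _ eik) IHp.
Qed.

Lemma transport_tildeE (R : realType) (n : nat) (W r : 'M[R]_n)
    (a : 'I_n -> R) (y : 'cV[R]_n) (i : 'I_n) :
  transport W r a y i 0 =
  \sum_j (tilde_y a y i - tilde_y a y j) * tilde_w W r a i j.
Proof. by rewrite mxE; apply: eq_bigr => j _; rewrite -mulrA. Qed.

Lemma tilde_wC (R : realType) (n : nat) (W r : 'M[R]_n) (a : 'I_n -> R) :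
  W^T = W -> r^T = r -> forall i j, tilde_w W r a i j = tilde_w W r a j i.
Proof.
move=> WT rT i j; rewrite /tilde_w -[in LHS]WT -[in LHS]rT !mxE.
by rewrite (addrC (a i)).
Qed.

(** Isolates the product [W i j * r i j], which carries the sign, from a factor that is positive
    when [a] is. *)
Lemma tilde_wE (R : realType) (n : nat) (W r : 'M[R]_n) (a : 'I_n -> R) i j :
  tilde_w W r a i j = W i j * r i j * (2 / (a i + a j)).
Proof. by rewrite /tilde_w; ring. Qed.

Lemma inner_transport (R : realType) (n : nat) (W r : 'M[R]_n)
    (a : 'I_n -> R) (c : R) (y : 'cV[R]_n) :
  W^T = W -> r^T = r ->
  inner (Xmx c a) y (transport W r a y) =
  c / 2 * \sum_i \sum_j
    (tilde_y a y i - tilde_y a y j) ^+ 2 * tilde_w W r a i j.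
Proof.
move=> WT rT; rewrite inner_XmxE -mulrA -dirichlet_form; last exact: tilde_wC.
by congr (_ * _); apply: eq_bigr => i _; rewrite transport_tildeE.
Qed.

(** The sign conditions matter: on a graph with a single edge, a negative product [W i j * r i j]
    there makes the form negative as soon as [tilde_y] differs across it, and a zero product makes
    the operator vanish. *)
Theorem theorem3p3 (R : realType) (n : nat) (e : rel 'I_n) (W r : 'M[R]_n)
    (a : 'I_n -> R) (c : R)
    (He : simple_graph e) (HW : weight_matrix e W)
    (Ha : forall i, 0 < a i) (Hr : r^T = r) (Hc : 0 < c) :
  [/\ posdef (Xmx c a),
      forall y : 'cV[R]_n,
        inner (Xmx c a) y (transport W r a y) =
        c / 2 * \sum_i \sum_j
          (tilde_y a y i - tilde_y a y j) ^+ 2 * tilde_w W r a i j,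
      (forall i j, e i j -> 0 <= W i j * r i j) ->
        nonneg_in (Xmx c a) (transport W r a)
    & (forall i j, e i j -> 0 < W i j * r i j) ->
        forall y : 'cV[R]_n,
          transport W r a y = 0 <-> constant_on_components e (tilde_y a y)].
Proof.
case: HW => WT W0.
have d0 i j : 0 < 2 / (a i + a j) by rewrite divr_gt0 ?addr_gt0.
(* Stated termwise, so that it serves both the sign of the sum and the vanishing of each term. Off
   the edges [W] is zero. *)
have form_ge0 : (forall i j, e i j -> 0 <= W i j * r i j) ->
    forall (y : 'cV[R]_n) i j,
    0 <= (tilde_y a y i - tilde_y a y j) ^+ 2 * tilde_w W r a i j.
  move=> Wr0 y i j; rewrite mulr_ge0 ?sqr_ge0 // tilde_wE.
  rewrite mulr_ge0 ?(ltW (d0 _ _)) //.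
  by have [/Wr0 // | /W0 ->] := boolP (e i j); rewrite mul0r.
split; first exact: posdef_Xmx.
- by move=> y; exact: inner_transport.
- move=> Wr0 y; rewrite inner_transport // mulr_ge0 ?divr_ge0 ?(ltW Hc) //.
  by do 2![apply: sumr_ge0 => ? _]; exact: form_ge0.
move=> Wr0 y; rewrite constant_on_componentsP.
have {form_ge0} ge0 := form_ge0 (fun i j eij => ltW (Wr0 i j eij)) y.
split=> [Ty0 i j eij | yE].
  have := inner_transport a c y WT Hr.
  rewrite Ty0 /inner mulmx0 mxE => /esym/eqP.
  (* A zero sum of non-negative terms has only zero terms: first for the outer sum, then for the
     inner one. *)
  rewrite mulf_eq0 gt_eqF ?divr_gt0 //= psumr_eq0 => [/allP/(_ i)|k _]; last first.
    exact: sumr_ge0.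
  rewrite mem_index_enum psumr_eq0 // => /(_ isT)/allP/(_ j).
  rewrite mem_index_enum mulf_eq0 tilde_wE => /(_ isT).
  rewrite (gt_eqF (mulr_gt0 (Wr0 i j eij) (d0 i j))) orbF sqrf_eq0 subr_eq0.
  by move/eqP.
(* The converse bypasses the form: in each summand the difference vanishes on an edge, the weight
   off the edges. *)
apply/colP => i; rewrite transport_tildeE mxE big1 // => j _.
have [/yE -> | /W0 Wij0] := boolP (e i j); first by rewrite subrr mul0r.
by rewrite /tilde_w Wij0 mul0r mulr0.
Qed.
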